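(* For every irrational $\alpha\in\mathbb{R}\setminus\mathbb{Q}$, \[ \mathcal{A}(\alpha)\ \subset\ \bigcap_{\epsilon>0}\ \liminf_{\frac pq\to\alpha} S_-\Big(\frac pq,\epsilon\Big), \qquad\text{where}\quad \liminf_{\frac pq\to\alpha} S_-\Big(\frac pq,\epsilon\Big):=\bigcup_{\delta>0}\ \bigcap_{|\frac pq-\alpha|<\delta} S_-\Big(\frac pq,\epsilon\Big), \] the inner intersection being over all rational numbers $p/q$ with $|p/q-\alpha|<\delta$.
   Context: Let $\eta>0$ and let $f$ be a $2\pi$-periodic function, analytic in the strip $\{z\in\mathbb{C} : |\mathrm{Im}\, z|\le \eta\}$ and real-valued on $\mathbb{R}$. For $\alpha\in\mathbb{R}$ and $0\le\theta<2\pi$ set $V_{\alpha,\theta}(n)=f(2\pi\alpha n+\theta)$, and let $H_{\alpha,\theta}$ be the discrete Schr\''odinger operator on $\ell^2(\mathbb{N})$, $\mathbb{N}=\{1,2,\dots\}$, given by $[H_{\alpha,\theta}\psi](n)=\psi(n+1)+\psi(n-1)+V_{\alpha,\theta}(n)\psi(n)$, where formally $\psi(0)=0$. Rational numbers are written $p/q$ in lowest terms with $q\ge1$. For $\alpha=p/q$ the potential is $q$-periodic, and $\sigma(p/q,\theta)$ denotes the essential spectrum of $H_{p/q,\theta}$ (i.e. the spectrum of the half-line operator without its possible simple eigenvalues); it is a union of $q$ closed intervals. Equivalently, $\sigma(p/q,\theta)=\{E\in\mathbb{R} : |\mathrm{tr}\,\Phi_q(E,p/q,\theta)|\le 2\}$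 with $\Phi_q$ as below. For $\epsilon>0$ set \[ S_-\Big(\frac pq,\epsilon\Big)=\bigcap_{0\le\theta<2\pi}\Big\{E\in\mathbb{R} : \mathrm{dist}\big(E,\sigma(\tfrac pq,\theta)\big)<\epsilon\Big\},\qquad \mathrm{dist}(E,K)=\inf_{E'\in K}|E-E'|. \] Transfer matrices: $T_n(E,\alpha,\theta)=\begin{pmatrix} E-V_{\alpha,\theta}(n) & -1\\ 1 & 0\end{pmatrix}$ and $\Phi_n(E,\alpha,\theta)=T_n(E,\alpha,\theta)\cdots T_2(E,\alpha,\theta)T_1(E,\alpha,\theta)$. The Lyapunov exponent is $\bar\gamma(E,\alpha)=\lim_{n\to\infty}\frac1n\cdot\frac{1}{2\pi}\int_0^{2\pi}\ln\|\Phi_n(E,\alpha,\theta)\|\,d\theta$. For $\alpha$ irrational, $\mathcal{A}(\alpha)=\{E\in\mathbb{R} : \bar\gamma(E,\alpha)=0\}$. *)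

(* Defs.v *)
From mathcomp Require Import all_boot all_order all_algebra.
From mathcomp Require Import complex.
From mathcomp Require Import all_classical all_reals all_analysis.

Set Implicit Arguments.
Unset Strict Implicit.
Unset Printing Implicit Defensive.
Import Order.TTheory GRing.Theory Num.Theory.
Import numFieldNormedType.Exports.

Local Open Scope classical_set_scope.
Local Open Scope ring_scope.
Local Open Scope complex_scope.

(* [derivable] is taken over the scalar field R[i], so this is complex
   differentiability; analyticity on a set that is not open means complex
   differentiability on a neighborhood of each of its points. *)
Definition analytic_on (R : realType) (f : R[i] -> R[i]) (D : set R[i]) : Prop :=
  forall z : R[i]^o, D z ->
    \forall w \near z, derivable (f : R[i]^o -> R[i]^o) w 1.

Definition strip (R : realType) (eta : R) : set R[i] :=
  [set z | `|complex.Im z| <= eta].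

Definition ell2 (R : realType) (psi : nat -> R[i]) : Prop :=
  cvgn (series (fun n => ComplexField.Normc.normc (psi n) ^+ 2)).

Definition ell2_norm (R : realType) (psi : nat -> R[i]) : R :=
  Num.sqrt (limn (series (fun n => ComplexField.Normc.normc (psi n) ^+ 2))).

(* Only the restriction of S to ell2 matters. *)
Definition bounded_linear_on_ell2 (R : realType)
    (S : (nat -> R[i]) -> nat -> R[i]) : Prop :=
  [/\ forall psi, ell2 psi -> ell2 (S psi),
      forall (a : R[i]) psi phi, ell2 psi -> ell2 phi ->
        S (fun n => a * psi n + phi n) = (fun n => a * S psi n + S phi n)
    & exists K : R, forall psi, ell2 psi ->
        ell2_norm (S psi) <= K * ell2_norm psi].

(* The resolvent set and the spectrum are those of a bounded operator T,
   everywhere defined on ell2: S is the inverse of T - z. *)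
Definition resolvent_set (R : realType)
    (T : (nat -> R[i]) -> nat -> R[i]) : set R[i] :=
  [set z | exists S : (nat -> R[i]) -> nat -> R[i],
    bounded_linear_on_ell2 S /\
    forall psi, ell2 psi ->
      S (fun n => T psi n - z * psi n) = psi /\
      (fun n => T (S psi) n - z * S psi n) = psi].

Definition spectrum (R : realType)
    (T : (nat -> R[i]) -> nat -> R[i]) : set R[i] := ~` resolvent_set T.

Definition eigenspace_ell2 (R : realType) (T : (nat -> R[i]) -> nat -> R[i])
    (z : R[i]) : set (nat -> R[i]) :=
  [set psi | ell2 psi /\ forall n, T psi n = z * psi n].

Definition finite_multiplicity_eigenvalue (R : realType)
    (T : (nat -> R[i]) -> nat -> R[i]) (z : R[i]) : Prop :=
  (exists psi, eigenspace_ell2 T z psi /\ exists n, psi n != 0) /\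
  (exists (m : nat) (v : 'I_m -> nat -> R[i]),
     forall psi, eigenspace_ell2 T z psi ->
       exists c : 'I_m -> R[i], forall n, psi n = \sum_k c k * v k n).

Definition discrete_spectrum (R : realType)
    (T : (nat -> R[i]) -> nat -> R[i]) : set R[i] :=
  [set z | isolated (spectrum T : set R[i]^o) z /\
           finite_multiplicity_eigenvalue T z].

(* For a self-adjoint T (the only case used), this is the usual essential
   spectrum. *)
Definition essential_spectrum (R : realType)
    (T : (nat -> R[i]) -> nat -> R[i]) : set R[i] :=
  spectrum T `\` discrete_spectrum T.

(* Taking the real part is harmless: f is assumed real-valued on the reals. *)
Definition potential (R : realType) (f : R[i] -> R[i]) (alpha theta : R)
    (n : nat) : R :=
  complex.Re (f (2 * pi * alpha * n%:R + theta)%:C).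

(* Sequences on {1, 2, ...} are encoded as functions on nat: psi k is the
   value at the site k.+1. *)
Definition schrodinger (R : realType) (f : R[i] -> R[i]) (alpha theta : R)
    (psi : nat -> R[i]) : nat -> R[i] :=
  fun k => psi k.+1 + (if k is k'.+1 then psi k' else 0)
           + (potential f alpha theta k.+1)%:C * psi k.

Definition sigma (R : realType) (f : R[i] -> R[i]) (r : rat) (theta : R) :
    set R :=
  [set E | essential_spectrum (schrodinger f (ratr r) theta) E%:C].

(* Extended-real-valued, so that the distance to the empty set is +oo. *)
Definition set_dist (R : realType) (E : R) (K : set R) : \bar R :=
  ereal_inf [set (`|E - E'|)%:E | E' in K].

Definition S_minus (R : realType) (f : R[i] -> R[i]) (r : rat) (eps : R) :
    set R :=
  \bigcap_(theta in [set t : R | 0 <= t < 2 * pi])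
    [set E | (set_dist E (sigma f r theta) < eps%:E)%E].

Definition liminf_S_minus (R : realType) (f : R[i] -> R[i]) (alpha eps : R) :
    set R :=
  \bigcup_(delta in [set d : R | 0 < d])
    \bigcap_(r in [set r : rat | `|ratr r - alpha| < delta]) S_minus f r eps.

Definition transfer (R : realType) (f : R[i] -> R[i]) (E alpha theta : R)
    (n : nat) : 'M[R]_2 :=
  \matrix_(i, j)
    if i == 0 then (if j == 0 then E - potential f alpha theta n else -1)
    else (if j == 0 then 1 else 0).

Fixpoint Phi (R : realType) (f : R[i] -> R[i]) (E alpha theta : R)
    (n : nat) : 'M[R]_2 :=
  if n is m.+1 then transfer f E alpha theta n *m Phi f E alpha theta m
  else 1%:M.

Definition euclidean_norm (R : realType) (v : 'cV[R]_2) : R :=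
  Num.sqrt (\sum_i v i 0 ^+ 2).

Definition operator_norm (R : realType) (A : 'M[R]_2) : R :=
  sup [set euclidean_norm (A *m v)
      | v in [set v : 'cV[R]_2 | euclidean_norm v <= 1]].

Definition is_lyapunov_exponent (R : realType) (f : R[i] -> R[i])
    (E alpha gamma : R) : Prop :=
  (fun n : nat => n%:R^-1 * ((2 * pi)^-1 *
     \int[lebesgue_measure]_(theta in `[0, 2 * pi]%classic)
        ln (operator_norm (Phi f E alpha theta n)))) @ \oo --> gamma.

Definition zero_lyapunov_set (R : realType) (f : R[i] -> R[i]) (alpha : R) :
    set R :=
  [set E | is_lyapunov_exponent f E alpha 0].

(* Main.v *)
Require Import Defs.
From mathcomp Require Import all_boot all_order all_algebra.
From mathcomp Require Import complex.
From mathcomp Require Import all_classical all_reals all_analysis.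
From mathcomp Require Import ring lra.

Set Implicit Arguments.
Unset Strict Implicit.
Unset Printing Implicit Defensive.
Import Order.TTheory GRing.Theory Num.Theory.
Import numFieldNormedType.Exports.

Local Open Scope classical_set_scope.
Local Open Scope ring_scope.
Local Open Scope complex_scope.

(* Let D(E) be the trace of Phi_q(E, p/q, theta).
   If |D(E)| <= 2, no nonzero solution vanishes at infinity, so E is in the
   essential spectrum. Hence if E is at distance >= eps from it, |D| > 2 on
   (E - eps, E + eps), and the roots of D, all real, stay at distance >= eps
   from E. At z = E + i eps^2/2 the Wronskian identity makes Bloch solutions
   grow exponentially; since D is a product over its roots, passing from z
   back to E loses at most a factor (1 + eps^2/4)^(q/2), which is smaller.
   So Phi_q has an eigenvalue w with ln |w| >= c q, c depending on eps only.
   On the other hand ln |w| is at most 1/n times the sum of ln ||Phi_n|| over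
   the q points theta + 2 pi m/q. As p/q tends to alpha, q tends to infinity
   and this is a Riemann sum, so ln |w| <= q (o(1) + the n-th average defining
   the Lyapunov exponent at alpha), uniformly in theta. If the exponent
   vanishes, this contradicts ln |w| >= c q once n and then q are large. *)

(** * Transfer cocycles *)

Section Cocycle.
Variable A : comNzRingType.
Implicit Types (a u : nat -> A) (M N : 'M[A]_2).

(** With [x = E - V(n)] this is the transfer matrix. The ring stays general because the entries are
    in turn real numbers, complex numbers and polynomials in the energy. *)
Definition step (x : A) : 'M[A]_2 :=
  \matrix_(i, j)
    if i == 0 then (if j == 0 then x else -1)
    else (if j == 0 then 1 else 0).

(** The factors are [a 1] to [a n]; [a 0] never enters, as sites start at 1. *)
Fixpoint cocycle a (n : nat) : 'M[A]_2 :=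
  if n is m.+1 then step (a n) *m cocycle a m else 1%:M.

Definition solution a u := forall n, u n.+2 = a n.+1 * u n.+1 - u n.

Definition state u n : 'cV[A]_2 :=
  \col_i if i == 0 then u n.+1 else u n.

Lemma big_ord2 (F : 'I_2 -> A) : \sum_i F i = F 0 + F 1.
Proof.
rewrite !big_ord_recl big_ord0 addr0; congr (F _ + F _); exact/val_inj.
Qed.

Lemma mul2E M (v : 'cV[A]_2) i : (M *m v) i 0 = M i 0 * v 0 0 + M i 1 * v 1 0.
Proof. by rewrite mxE big_ord2. Qed.

Lemma mulM2E M N i j : (M *m N) i j = M i 0 * N 0 j + M i 1 * N 1 j.
Proof. by rewrite mxE big_ord2. Qed.

Lemma tr2E M : \tr M = M 0 0 + M 1 1.
Proof. exact: big_ord2. Qed.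

Lemma det2E M : \det M = M 0 0 * M 1 1 - M 0 1 * M 1 0.
Proof.
rewrite (expand_det_row _ 0) big_ord2 /cofactor /=.
rewrite !det_mx11 !mxE expr0 expr1 mul1r mulN1r mulrN.
by congr (M _ _ * M _ _ - M _ _ * M _ _); apply/val_inj.
Qed.

Lemma ord2P (i : 'I_2) : i = 0 \/ i = 1.
Proof. by case: i => [[|[|]]] // h; [left|right]; apply/val_inj. Qed.

Lemma mx2P M N : M 0 0 = N 0 0 -> M 0 1 = N 0 1 -> M 1 0 = N 1 0 ->
  M 1 1 = N 1 1 -> M = N.
Proof. by move=> ? ? ? ?; apply/matrixP => i j; case: (ord2P i) => ->; case: (ord2P j) => ->. Qed.

Lemma cV2P (v w : 'cV[A]_2) : v 0 0 = w 0 0 -> v 1 0 = w 1 0 -> v = w.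
Proof. by move=> ? ?; apply/matrixP => i j; rewrite (ord1 j); case: (ord2P i) => ->. Qed.

Lemma CayleyHamilton2 M : M *m M = \tr M *: M - (\det M)%:M.
Proof.
by rewrite tr2E det2E; apply: mx2P; rewrite !(mulM2E, mxE) /=; ring.
Qed.

Lemma det_step x : \det (step x) = 1.
Proof. by rewrite det2E !mxE /=; ring. Qed.

Lemma det_cocycle a n : \det (cocycle a n) = 1.
Proof. by elim: n => [|n IHn] /=; rewrite ?det1// det_mulmx det_step IHn mulr1. Qed.

Lemma step_state a u n : solution a u -> state u n.+1 = step (a n.+1) *m state u n.
Proof.
move=> su; apply: cV2P; rewrite mul2E !mxE /=; first by rewrite su; ring.
by ring.
Qed.

Lemma state_cocycle a u n : solution a u -> state u n = cocycle a n *m state u 0.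
Proof.
move=> su; elim: n => [|n IHn]; first by rewrite mul1mx.
by rewrite (step_state _ su) IHn mulmxA.
Qed.

(** The solution whose state at 0 is [v], so [v] lists [u 1] above [u 0]. *)
Definition trajectory a (v : 'cV[A]_2) (n : nat) : A := (cocycle a n *m v) 1 0.

Lemma trajectoryE a v n : state (trajectory a v) n = cocycle a n *m v.
Proof.
apply: cV2P; last by rewrite mxE.
rewrite mxE /= /trajectory /= -mulmxA mul2E [step _ 1 0]mxE [step _ 1 1]mxE /=.
by rewrite mul1r mul0r addr0.
Qed.

Lemma trajectory_solution a v : solution a (trajectory a v).
Proof.
move=> n; have e0 := trajectoryE a v n; have e1 := trajectoryE a v n.+1.
have e2 : state (trajectory a v) n.+1 = step (a n.+1) *m state (trajectory a v) n.
  by rewrite e1 e0 mulmxA.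
have /matrixP/(_ 0 0) := e2; rewrite mul2E !mxE /= => ->.
by rewrite mulN1r.
Qed.

Lemma solution_eq0 a u : solution a u -> u 0%N = 0 -> u 1%N = 0 -> forall n, u n = 0.
Proof.
move=> su u0 u1 n; suff: u n = 0 /\ u n.+1 = 0 by case.
by elim: n => // n [IH1 IH2]; split=> //; rewrite su IH1 IH2 mulr0 subrr.
Qed.

(** * Periodic coefficients and the monodromy matrix [cocycle a q] *)

Section Periodic.
Variables (a : nat -> A) (q : nat).
Hypothesis aq : forall n, a (n + q)%N = a n.

Lemma solution_shift u : solution a u -> solution a (fun n => u (n + q)%N).
Proof. by move=> su n; rewrite !addSn su -(aq n.+1). Qed.

(** The defect of the relation is again a solution. Its state at 0 vanishes by Cayley-Hamilton for
    the monodromy matrix, whose determinant is 1. *)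
Lemma solution_trace u n : solution a u ->
  u (n + q + q)%N = \tr (cocycle a q) * u (n + q)%N - u n.
Proof.
move=> su; set t := \tr _; apply/eqP; rewrite -subr_eq0; apply/eqP.
pose w n := u (n + q + q)%N - (t * u (n + q)%N - u n).
have sw : solution a w.
  move=> k; rewrite /w !addSn.
  have -> := solution_shift (solution_shift su) k; have -> := solution_shift su k.
  by rewrite su !addSn; ring.
have Eq k : state u (k + q)%N = state (fun n => u (n + q)%N) k.
  by apply: cV2P; rewrite !mxE.
have s1 : state u q = cocycle a q *m state u 0 by rewrite (state_cocycle _ su).
have s2 : state u (q + q) = cocycle a q *m state u q.
  rewrite Eq (state_cocycle _ (solution_shift su)) -Eq add0n.
  by rewrite (state_cocycle _ su).
have w0 : state w 0 = 0.
  transitivity (state u (q + q) - (t *: state u q - state u 0)).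
    by apply: cV2P; rewrite !mxE.
  rewrite s2 s1 mulmxA CayleyHamilton2 det_cocycle mulmxBl mul1mx scalemxAl.
  by rewrite subrr.
apply: (solution_eq0 sw).
  by have /matrixP/(_ 1 0) := w0; rewrite !mxE.
by have /matrixP/(_ 0 0) := w0; rewrite !mxE.
Qed.

(** Both sides solve the recurrence in [n], and the eigenvector equation says that their states at 0
    agree. *)
Lemma bloch_trajectory w v : cocycle a q *m v = w *: v ->
  forall n, trajectory a v (n + q) = w * trajectory a v n.
Proof.
move=> ev n; apply/eqP; rewrite -subr_eq0; apply/eqP; pose u := trajectory a v.
pose d n := u (n + q)%N - w * u n.
have su : solution a u by exact: trajectory_solution.
have sd : solution a d.
  by move=> k; rewrite /d; have -> := solution_shift su k; rewrite su; ring.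
have e1 := trajectoryE a v q; rewrite ev in e1.
have e0 := trajectoryE a v 0; rewrite mul1mx in e0.
apply: (solution_eq0 sd); rewrite /d /u.
  have /matrixP/(_ 1 0) := e1; have /matrixP/(_ 1 0) := e0.
  by rewrite !mxE /= => -> ->; rewrite subrr.
have /matrixP/(_ 0 0) := e1; have /matrixP/(_ 0 0) := e0.
by rewrite !mxE /= add1n => -> ->; rewrite subrr.
Qed.

End Periodic.
End Cocycle.

Lemma map_cocycle (A B : comNzRingType) (g : {rmorphism A -> B}) a n :
  map_mx g (cocycle a n) = cocycle (g \o a) n.
Proof.
elim: n => [|n IHn] /=; first by rewrite map_mx1.
rewrite map_mxM IHn; congr (_ *m _); apply: mx2P; rewrite !mxE //= ?rmorphN ?rmorph1 ?rmorph0//.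
Qed.

Lemma Phi_cocycle (R : realType) (f : R[i] -> R[i]) E alpha theta n :
  Phi f E alpha theta n = cocycle (fun k => E - potential f alpha theta k) n.
Proof. by elim: n => //= n ->. Qed.

Lemma eigenvector2 (F : fieldType) (M : 'M[F]_2) w :
  w ^+ 2 - \tr M * w + \det M = 0 -> exists2 v : 'cV[F]_2, v != 0 & M *m v = w *: v.
Proof.
(* [det0P] yields a row vector, hence the transposes. *)
move=> h; have /eqP/det0P[v v0 hv] : \det (M - w%:M)^T = 0.
  by rewrite det_tr -h det2E tr2E det2E !mxE /=; ring.
exists v^T; first by rewrite -(inj_eq (@trmx_inj _ _ _)) trmx0 trmxK.
apply/eqP; rewrite -subr_eq0 -mul_scalar_mx -mulmxBl.
by rewrite -(inj_eq (@trmx_inj _ _ _)) trmx0 trmx_mul trmxK hv.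
Qed.

(** * Essential spectrum of periodic operators *)

Definition vanishing (R : realType) (x : nat -> R) :=
  forall e, 0 < e -> exists N, forall n, (N <= n)%N -> `|x n| < e.

(** The quadratic form [Q] is invariant under the recurrence, hence zero along a vanishing sequence.
    By the identity [eqQ] this forces [x 0 = 0] if [|D| < 2]; if [|D| = 2] it makes [x j ^+ 2]
    constant in [j], and a constant that tends to 0 is 0. *)
Lemma vanishing_trace_eq0 (R : realType) (D : R) (x : nat -> R) :
  `|D| <= 2 -> (forall j, x j.+2 = D * x j.+1 - x j) -> vanishing x -> x 0%N = 0.
Proof.
move=> D2 xrec x0.
pose Q j := x j.+1 ^+ 2 - D * x j.+1 * x j + x j ^+ 2.
have QE j : Q j = Q 0%N.
  by elim: j => // j <-; rewrite /Q xrec; ring.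
have D2' : D ^+ 2 <= 4.
  have := D2; rewrite ler_norml => /andP[]; nra.
have Q0 : Q 0%N = 0.
  apply/eqP; rewrite -normr_le0; apply/ler_addgt0Pr => e e0; rewrite add0r.
  (* Below this bound both squares are at most [e / 4] and the mixed term at most [2 * (e / 4)], in
     total [e]. *)
  have s0 : 0 < Num.min 1 (e / 4) by rewrite lt_min ltr01 divr_gt0.
  have [N HN] := x0 _ s0.
  have := HN N (leqnn _); have := HN N.+1 (leqnSn _).
  rewrite !lt_min -(QE N) /Q => /andP[a1 a2] /andP[b1 b2].
  set u := x N.+1 in a1 a2 *; set v := x N in b1 b2 *.
  have -> : u ^+ 2 - D * u * v + v ^+ 2 = u * u + (- (D * (u * v)) + v * v) by ring.
  apply: (le_trans (ler_normD _ _)); apply: (le_trans (lerD (lexx _) (ler_normD _ _))).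
  rewrite normrN !normrM.
  have : 0 <= `|u| by []. have : 0 <= `|v| by []. have : 0 <= `|D| by [].
  move: a1 a2 b1 b2 D2; move: (`|u|) (`|v|) (`|D|) => U V d ? ? ? ? ? ? ? ?.
  have UU : U * U <= e / 4 by nra.
  have VV : V * V <= e / 4 by nra.
  have UV : U * V <= e / 4 by nra.
  have dUV : d * (U * V) <= 2 * (e / 4) by apply: ler_pM => //; nra.
  lra.
have eqQ j : (2 * x j.+1 - D * x j) ^+ 2 + (4 - D ^+ 2) * x j ^+ 2 = 0.
  by transitivity (4 * Q j); [rewrite /Q; ring | rewrite QE Q0 mulr0].
have [D4|D4] := eqVneq (D ^+ 2) 4; last first.
  have d4 : 0 < 4 - D ^+ 2 by rewrite subr_gt0 lt_neqAle D4.
  have := eqQ 0%N; have := sqr_ge0 (2 * x 1%N - D * x 0%N).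
  have := sqr_ge0 (x 0%N) => ? ? ?.
  by apply/eqP; rewrite -sqrf_eq0; apply/eqP; nra.
have xj j : x j ^+ 2 = x 0%N ^+ 2.
  elim: j => // j <-; have := eqQ j; rewrite D4 subrr mul0r addr0 => /eqP.
  rewrite sqrf_eq0 subr_eq0 => /eqP h.
  have : (2 * x j.+1) ^+ 2 = (D * x j) ^+ 2 by rewrite h.
  by rewrite !exprMn D4 => h2; nra.
apply/eqP; rewrite -normr_le0; apply/ler_addgt0Pr => e e0; rewrite add0r.
have [N HN] := x0 _ e0; have := HN N (leqnn _) => /ltW; apply: le_trans.
by rewrite -(ler_pXn2r (n := 2)) ?nnegrE// !real_normK ?num_real// (xj N).
Qed.

(** Sampled once per period, a solution obeys the constant-coefficient recurrence given by
    [solution_trace]. *)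
Lemma vanishing_solution_eq0 (R : realType) (a : nat -> R) (q : nat) (u : nat -> R) :
  (0 < q)%N -> (forall n, a (n + q)%N = a n) -> `|\tr (cocycle a q)| <= 2 ->
  solution a u -> vanishing u -> forall m, u m = 0.
Proof.
move=> q0 aq tr2 su u0 m.
pose x j := u (m + j * q)%N.
have -> : u m = x 0%N by rewrite /x addn0.
apply: (@vanishing_trace_eq0 _ (\tr (cocycle a q)) x) => //.
  by move=> j; rewrite /x !mulSnr !addnA (solution_trace aq _ su).
move=> e e0; have [N HN] := u0 e e0; exists N => n Nn; apply: HN.
by rewrite (leq_trans Nn)// (leq_trans (leq_pmulr _ q0))// leq_addl.
Qed.

Section EssentialSpectrum.
Variables (R : realType) (f : R[i] -> R[i]).

Lemma vanishing_normc (psi : nat -> R[i]) :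
  vanishing (fun n => ComplexField.Normc.normc (psi n) ^+ 2) ->
  vanishing (fun n => complex.Re (psi n)) /\ vanishing (fun n => complex.Im (psi n)).
Proof.
move=> v; split => e e0; have [N HN] := v (e ^+ 2) (exprn_gt0 2 e0); exists N => n /HN;
  rewrite /ComplexField.Normc.normc; case: (psi n) => x y /=;
  rewrite sqr_sqrtr ?addr_ge0 ?sqr_ge0// ger0_norm ?addr_ge0 ?sqr_ge0// => h;
  rewrite -(ltr_pXn2r (n := 2)) ?nnegrE ?(ltW e0)// real_normK ?num_real//;
  have := sqr_ge0 x; have := sqr_ge0 y; nra.
Qed.

Lemma ell2_vanishing (psi : nat -> R[i]) : ell2 psi ->
  vanishing (fun n => ComplexField.Normc.normc (psi n) ^+ 2).
Proof.
move=> /cvg_series_cvg_0 h e e0.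
move/cvgr0Pnorm_lt : h => /(_ e e0) [N _ HN]; exists N => n Nn; exact: HN.
Qed.

Lemma vanishingS (x : nat -> R) : vanishing (fun n => x n.+1) -> vanishing x.
Proof.
move=> v e /v[N HN]; exists N.+1 => -[//|n] Nn; exact: HN.
Qed.

(* A sequence on the half-line is extended to the site 0 by psi0, which is 0
   for eigenvectors and -1 for the image of the first basis vector under the
   resolvent. *)
Lemma halfline_solution_eq0 (E alpha theta : R) q (psi : nat -> R[i]) (psi0 : R[i]) :
  (0 < q)%N ->
  (forall n, potential f alpha theta (n + q) = potential f alpha theta n) ->
  `|\tr (Phi f E alpha theta q)| <= 2 -> ell2 psi ->
  (forall k, psi k.+1 + (if k is k'.+1 then psi k' else psi0)
           + (potential f alpha theta k.+1)%:C * psi k = E%:C * psi k) ->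
  psi0 = 0 /\ forall k, psi k = 0.
Proof.
move=> q0 per tr2 /ell2_vanishing/vanishing_normc[vr vi] eq.
pose phi n := if n is k.+1 then psi k else psi0.
pose a k := E - potential f alpha theta k.
have ap n : a (n + q)%N = a n by rewrite /a per.
have sphi n : phi n.+2 = (a n.+1)%:C * phi n.+1 - phi n.
  have -> : phi n.+2 = (psi n.+1 + phi n + (potential f alpha theta n.+1)%:C * psi n)
     - phi n - (potential f alpha theta n.+1)%:C * psi n by rewrite /=; ring.
  by rewrite {1}/phi eq /a rmorphB /=; ring.
rewrite Phi_cocycle in tr2.
have re n : complex.Re (phi n) = 0.
  apply: (vanishing_solution_eq0 q0 ap tr2 (u := fun n => complex.Re (phi n))).
    move=> k; rewrite sphi; case: (phi k.+1) (phi k) => [x y] [z t] /=; ring.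
  exact: vanishingS vr.
have im n : complex.Im (phi n) = 0.
  apply: (vanishing_solution_eq0 q0 ap tr2 (u := fun n => complex.Im (phi n))).
    move=> k; rewrite sphi; case: (phi k.+1) (phi k) => [x y] [z t] /=; ring.
  exact: vanishingS vi.
have phi0 n : phi n = 0 by apply/eqP; rewrite eq_complex re im !eqxx.
by split=> [|k]; [exact: (phi0 0%N)|exact: (phi0 k.+1)].
Qed.

Lemma ell2_delta0 : ell2 (fun n => (n == 0%N)%:R : R[i]).
Proof.
apply/cvg_ex; exists 1; apply: cvg_near_cst; exists 1%N => // -[//|n] _.
rewrite seriesEnat /= big_nat_recl//= big1 ?addr0.
  by rewrite /ComplexField.Normc.normc /= expr0n addr0 expr1n sqrtr1 expr1n.
by move=> i _; rewrite /ComplexField.Normc.normc /= expr0n addr0 sqrtr0 expr0n.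
Qed.

(** A resolvent at [E] would send the first basis vector to a square-summable solution with value -1
    at site 0; a point of the discrete spectrum would have an eigenvector, a nonzero such solution
    with value 0 there. [halfline_solution_eq0] excludes both. *)
Lemma essential_spectrum_trace (E alpha theta : R) q :
  (0 < q)%N ->
  (forall n, potential f alpha theta (n + q) = potential f alpha theta n) ->
  `|\tr (Phi f E alpha theta q)| <= 2 ->
  essential_spectrum (schrodinger f alpha theta) E%:C.
Proof.
move=> q0 per tr2; split.
- move=> [S [[S2 _ _] SE]]; have d2 := ell2_delta0; set d := (fun n : nat => _) in d2.
  have [_ /funeqP ES] := SE d d2.
  have := @halfline_solution_eq0 E alpha theta q (S d) (-1) q0 per tr2 (S2 _ d2).
  case=> [[|k]|/eqP e _]; last by rewrite oppr_eq0 oner_eq0 in e.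
  + have := ES 0%N; rewrite /schrodinger /d /= addr0 => /eqP; rewrite subr_eq => /eqP e.
    by rewrite addrAC e; ring.
  + by have := ES k.+1; rewrite /schrodinger /d /= => /eqP; rewrite subr_eq0 => /eqP.
- move=> [_ [[psi [[psi2 Epsi] [n psin]]] _]].
  have [k|_ psi0] := @halfline_solution_eq0 E alpha theta q psi 0 q0 per tr2 psi2.
    by rewrite -Epsi.
  by rewrite psi0 eqxx in psin.
Qed.

End EssentialSpectrum.

(** * Growth at distance eps from the spectrum *)

Definition sqnorm (R : realType) (z : R[i]) : R :=
  complex.Re z ^+ 2 + complex.Im z ^+ 2.

Section Floquet.
Variable R : realType.
Implicit Types (z w : R[i]) (V : nat -> R) (u : nat -> R[i]).

Lemma sqnorm_ge0 z : 0 <= sqnorm z.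
Proof. by rewrite addr_ge0 ?sqr_ge0. Qed.

Lemma sqnorm_eq0 z : sqnorm z = 0 -> z = 0.
Proof.
case: z => x y; rewrite /sqnorm /= => /eqP; rewrite paddr_eq0 ?sqr_ge0// !sqrf_eq0.
by move=> /andP[/eqP-> /eqP->].
Qed.

Lemma sqnormM z w : sqnorm (z * w) = sqnorm z * sqnorm w.
Proof. case: z w => [x y] [x' y']; rewrite /sqnorm /=; ring. Qed.

Lemma sqnorm_real (x : R) : sqnorm x%:C = x ^+ 2.
Proof. by rewrite /sqnorm /= expr0n addr0. Qed.

Lemma sqnormB z w : sqnorm (z - w) <= 2 * sqnorm z + 2 * sqnorm w.
Proof.
case: z w => [x y] [x' y']; rewrite /sqnorm /=.
have := sqr_ge0 (x + x'); have := sqr_ge0 (y + y'); nra.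
Qed.

Definition cpx_energy V z n : R[i] := z - (V n)%:C.

(** The imaginary part of [conj (u n) * u n.+1]. The potential being real, it changes along a
    solution only through [Im z]. *)
Definition wronskian u n : R :=
  complex.Re (u n) * complex.Im (u n.+1) - complex.Im (u n) * complex.Re (u n.+1).

Lemma wronskianS V z u n : solution (cpx_energy V z) u ->
  wronskian u n.+1 = wronskian u n + complex.Im z * sqnorm (u n.+1).
Proof.
move=> su; rewrite /wronskian su /cpx_energy /sqnorm.
by case: z (u n) (u n.+1) {su} => [x y] [a b] [c d] /=; ring.
Qed.

Lemma wronskian_sum V z u n : solution (cpx_energy V z) u ->
  wronskian u n = wronskian u 0 + complex.Im z * \sum_(k < n) sqnorm (u k.+1).
Proof.
move=> su; elim: n => [|n IHn]; first by rewrite big_ord0 mulr0 addr0.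
by rewrite (wronskianS _ su) IHn big_ord_recr /=; ring.
Qed.

Lemma wronskian_le u n : 2 * wronskian u n <= sqnorm (u n) + sqnorm (u n.+1).
Proof.
rewrite /wronskian /sqnorm; case: (u n) (u n.+1) => [a b] [c d] /=.
have := sqr_ge0 (a - d); have := sqr_ge0 (b + c); nra.
Qed.

(** * Bloch solutions and their multipliers *)

Section Bloch.
Variables (V : nat -> R) (q : nat) (z w : R[i]).
Hypotheses (q_gt0 : (0 < q)%N) (Vq : forall n, V (n + q)%N = V n).
Hypothesis w_eigen : w ^+ 2 - \tr (cocycle (cpx_energy V z) q) * w + 1 = 0.

Lemma bloch_neq0 : w != 0.
Proof.
apply/eqP => w0; have := w_eigen; rewrite w0 expr0n mulr0 subrr add0r => /eqP.
by rewrite oner_eq0.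
Qed.

Lemma bloch_solution : exists u, [/\ solution (cpx_energy V z) u,
  forall n, u (n + q)%N = w * u n & 0 < \sum_(k < q) sqnorm (u k.+1)].
Proof.
have ap n : cpx_energy V z (n + q)%N = cpx_energy V z n by rewrite /cpx_energy Vq.
have [|v v0 ev] := @eigenvector2 _ (cocycle (cpx_energy V z) q) w.
  by rewrite det_cocycle.
exists (trajectory (cpx_energy V z) v); split; first exact: trajectory_solution.
  exact: bloch_trajectory.
set u := trajectory _ v; rewrite lt_neqAle sumr_ge0 ?andbT; last first.
  by move=> ? _; exact: sqnorm_ge0.
apply/negP => /eqP/esym s0.
have uk0 k : (k < q)%N -> u k.+1 = 0.
  move=> kq; apply: sqnorm_eq0.
  move/eqP: s0; rewrite psumr_eq0; last by move=> ? _; exact: sqnorm_ge0.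
  by move=> /allP/(_ (Ordinal kq) (mem_index_enum _))/eqP.
(* The sum omits site 0; [u q = w * u 0] with [w] nonzero recovers it. *)
have u0 : u 0%N = 0.
  have := bloch_trajectory ap ev 0; rewrite add0n -/u -(prednK q_gt0) uk0 ?prednK//.
  by move=> /esym/eqP; rewrite mulf_eq0 (negPf bloch_neq0) => /eqP.
have := trajectoryE (cpx_energy V z) v 0; rewrite mul1mx => sv.
move/eqP: v0; apply; rewrite -sv -/u.
by apply: cV2P; rewrite !mxE //= uk0.
Qed.

Lemma wronskian_bloch u n : (forall n, u (n + q)%N = w * u n) ->
  wronskian u (n + q) = sqnorm w * wronskian u n.
Proof.
move=> uw; rewrite /wronskian -addSn !uw /sqnorm.
by case: w (u n) (u n.+1) => [x y] [a b] [c d] /=; ring.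
Qed.

(** The Wronskian then returns to its value after one period, although it has gained [Im z] times a
    positive sum. *)
Lemma unimodular_multiplier_real : sqnorm w = 1 -> complex.Im z = 0.
Proof.
move=> w1; have [u [su uw s0]] := bloch_solution.
have := wronskian_sum q su; rewrite -{1}[q]add0n (wronskian_bloch 0 uw) w1 mul1r => /eqP.
rewrite -[X in X == _]addr0 (inj_eq (addrI _)) eq_sym mulf_eq0 (gt_eqF s0) orbF.
by move=> /eqP.
Qed.

(** Over one period the Wronskian increases strictly and is multiplied by [|w|^2 >= 1], so it is
    positive. Every two sites it gains a factor at least [1 + 2 Im z]; [q] such double steps make
    two periods, that is a factor [|w|^4]. *)
Lemma multiplier_growth : 0 < complex.Im z -> 1 <= sqnorm w ->
  (1 + 2 * complex.Im z) ^+ q <= sqnorm w ^+ 2.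
Proof.
move=> y0 w1; have [u [su uw s0]] := bloch_solution; set y := complex.Im z in y0 *.
have J0 : 0 < wronskian u 0.
  have := wronskian_sum q su; rewrite -{1}[q]add0n (wronskian_bloch 0 uw) -/y.
  move: (wronskian u 0) (sqnorm w) w1 (mulr_gt0 y0 s0) => J W W1; nra.
have Jn n : 0 < wronskian u n.
  rewrite (wronskian_sum n su) ltr_wpDr// mulr_ge0 ?(ltW y0)// sumr_ge0// => ? _.
  exact: sqnorm_ge0.
(* The two increments add [y * (|u(n+1)|^2 + |u(n+2)|^2)], at least [2 * y] times the Wronskian at
   [n+1], which dominates the one at [n]. *)
have J2 n : (1 + 2 * y) * wronskian u n <= wronskian u n.+2.
  rewrite (wronskianS _ su).
  have h1 := wronskianS n su; have h2 := wronskian_le u n.+1.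
  have := sqnorm_ge0 (u n.+1); rewrite h1 -/y in h2 *; nra.
have Jk k : (1 + 2 * y) ^+ k * wronskian u 0 <= wronskian u (k + k).
  elim: k => [|k IHk]; first by rewrite expr0 mul1r.
  rewrite addnS addSn exprS -mulrA; apply: le_trans (J2 _).
  by rewrite ler_wpM2l//; lra.
have := Jk q; rewrite (wronskian_bloch q uw) -{2}[q]add0n (wronskian_bloch 0 uw).
by rewrite mulrA -expr2 ler_pM2r.
Qed.

End Bloch.

(** The two roots have product 1, so one of them has modulus at least 1. *)
Lemma multiplier_exists (T : R[i]) : exists2 w, w ^+ 2 - T * w + 1 = 0 & 1 <= sqnorm w.
Proof.
have [w ew] : exists w, w ^+ 2 - T * w + 1 = 0.
  exists ((T + sqrtc (T ^+ 2 - 4)) / 2).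
  have := sqr_sqrtc (T ^+ 2 - 4); set s := sqrtc _ => es.
  have -> : ((T + s) / 2) ^+ 2 - T * ((T + s) / 2) + 1 = (s ^+ 2 - (T ^+ 2 - 4)) / 4 by field.
  by rewrite es subrr mul0r.
have [|w1] := leP 1 (sqnorm w); first by exists w.
exists (T - w); first by rewrite -ew; ring.
have e1 : w * (T - w) = 1 by apply/eqP; rewrite -subr_eq0 -oppr_eq0 -ew; apply/eqP; ring.
have := sqnormM w (T - w); rewrite e1 (_ : sqnorm 1 = 1); last first.
  by rewrite /sqnorm /= expr0n addr0 expr1n.
move=> h; have := sqnorm_ge0 (T - w); have := sqnorm_ge0 w.
move: (sqnorm w) (sqnorm (T - w)) h w1 => a b; nra.
Qed.

(** * The trace as a polynomial in the energy, and its growth *)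

Definition trace_poly V q : {poly R[i]} :=
  \tr (cocycle (fun n => 'X - ((V n)%:C)%:P : {poly R[i]}) q).

Lemma horner_trace_poly V q z :
  (trace_poly V q).[z] = \tr (cocycle (cpx_energy V z) q).
Proof.
rewrite -[LHS]/(horner_eval z (trace_poly V q)) -trace_map_mx map_cocycle.
by congr (\tr (cocycle _ _)); apply/funext => n /=; rewrite /horner_eval !hornerE.
Qed.

Lemma horner_trace_poly_real V q (E : R) :
  (trace_poly V q).[E%:C] = (\tr (cocycle (fun n => E - V n) q))%:C.
Proof.
rewrite horner_trace_poly -trace_map_mx map_cocycle.
by congr (\tr (cocycle _ _)); apply/funext => n /=; rewrite /cpx_energy rmorphB.
Qed.

Lemma size_trace_poly V q : (size (trace_poly V q) <= q.+1)%N.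
Proof.
pose a (n : nat) : {poly R[i]} := 'X - ((V n)%:C)%:P.
have h i j : (size (cocycle a q i j) <= q.+1)%N.
  elim: q i j => [|q IHq] i j /=.
    by rewrite mxE; case: (i == j); rewrite ?size_poly1 ?size_poly0.
  rewrite mulM2E; apply: (leq_trans (size_polyD _ _)); rewrite geq_max.
  apply/andP; split; apply: (leq_trans (size_polyMleq _ _)); rewrite mxE /=.
    case: (i == 0).
      rewrite size_XsubC; exact: IHq.
    by rewrite size_poly1 add1n /=; apply: (leq_trans (IHq _ _)).
  case: (i == 0); rewrite ?size_polyN ?size_poly1 ?size_poly0.
    by rewrite add1n /=; apply: (leq_trans (IHq _ _)).
  by rewrite add0n; apply: (leq_trans (leq_pred _)); apply: (leq_trans (IHq _ _)).
rewrite /trace_poly tr2E; apply: (leq_trans (size_polyD _ _)).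
by rewrite geq_max !h.
Qed.

(** For each root [l], [(E - l)^2 + y^2] is at most [(E - l)^2 * (1 + y^2 / eps^2)] because
    [|E - l| >= eps]; there are at most [q] roots. *)
Lemma real_rooted_vertical_growth (P : {poly R[i]}) (E y eps : R) (q : nat) :
  0 < eps -> (size P <= q.+1)%N ->
  (forall l, root P l -> complex.Im l = 0 /\ eps <= `|complex.Re l - E|) ->
  sqnorm P.[E +i* y] <= sqnorm P.[E%:C] * (1 + y ^+ 2 / eps ^+ 2) ^+ q.
Proof.
move=> e0 sP rP; set B := 1 + _.
have B1 : 1 <= B by rewrite lerDl divr_ge0 ?sqr_ge0.
have [->|P0] := eqVneq P 0.
  by rewrite !horner0 sqnorm_real expr0n mul0r.
have [s Ps] := closed_field_poly_normal P.
have ss : (size s <= q)%N.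
  by move: sP; rewrite Ps size_scale ?lead_coef_eq0// size_prod_XsubC ltnS.
have rs l : l \in s -> root P l.
  by move=> ls; rewrite Ps rootZ ?lead_coef_eq0// root_prod_XsubC.
rewrite Ps !hornerZ !horner_prod !sqnormM -!mulrA ler_wpM2l ?sqnorm_ge0//.
apply: (@le_trans _ _ (sqnorm (\prod_(j <- s) ('X - j%:P).[E%:C]) * B ^+ size s)); last first.
  by rewrite ler_wpM2l ?sqnorm_ge0// ler_weXn2l.
elim: s {Ps ss} rs => [|l s IHs] rs; first by rewrite !big_nil expr0 mulr1.
rewrite !big_cons !sqnormM exprS mulrACA ler_pM ?sqnorm_ge0//; last first.
  by apply: IHs => x xs; apply: rs; rewrite inE xs orbT.
have [im re] := rP l (rs l (mem_head _ _)).
have re2 : eps ^+ 2 <= (E - complex.Re l) ^+ 2.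
  rewrite -[leRHS]real_normK ?num_real// distrC ler_pXn2r ?nnegrE// ltW//.
rewrite !hornerXsubC /sqnorm; case: l im re2 {rs re} => a b /= -> re2.
rewrite !subr0 expr0n addr0 /B mulrDr mulr1 lerD2l mulrCA ler_peMr ?sqr_ge0//.
by rewrite ler_pdivlMr ?exprn_gt0// mul1r.
Qed.

(* Compares the trace at E with its value at E + i eps^2/2, where the multiplier
   is bounded below by [multiplier_growth]. *)
Lemma trace_growth V q (E eps : R) : (0 < q)%N -> (forall n, V (n + q)%N = V n) ->
  0 < eps -> 16 <= (1 + eps ^+ 2) ^+ q ->
  (forall E', `|E' - E| < eps -> 2 < `|\tr (cocycle (fun n => E' - V n) q)|) ->
  ((1 + eps ^+ 2) / (1 + eps ^+ 2 / 4) ^+ 2) ^+ q <=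
    16 * \tr (cocycle (fun n => E - V n) q) ^+ 4.
Proof.
move=> q0 Vq e0 big gap; set D := \tr _.
(* This height makes [1 + 2 y] equal to [1 + eps^2] and [y^2 / eps^2] equal to [eps^2 / 4]; the
   first base exceeds the square of the second for small [eps]. *)
pose y := eps ^+ 2 / 2; have y0 : 0 < y by rewrite divr_gt0// exprn_gt0.
have hT := @real_rooted_vertical_growth (trace_poly V q) E y eps q e0 (size_trace_poly _ _).
have {hT} hT : sqnorm (trace_poly V q).[E +i* y] <= D ^+ 2 * (1 + eps ^+ 2 / 4) ^+ q.
  rewrite -(sqnorm_real D) /D -horner_trace_poly_real.
  have -> : 1 + eps ^+ 2 / 4 = 1 + y ^+ 2 / eps ^+ 2 by rewrite /y; field; rewrite gt_eqF.
  apply: hT => l; rewrite /root => /eqP rl.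
  have iml : complex.Im l = 0.
    (* Where the trace vanishes the multiplier equation is [w^2 + 1 = 0], solved by the unimodular
       [i]. *)
    apply: (@unimodular_multiplier_real V q l 'i q0 Vq).
      rewrite -horner_trace_poly rl.
      by apply/eqP; rewrite eq_complex /=; apply/andP; split; apply/eqP; ring.
    by rewrite /sqnorm /= expr0n add0r expr1n.
  split=> //; rewrite leNgt; apply/negP => /gap.
  have -> : \tr (cocycle (fun n => complex.Re l - V n) q) = 0.
    apply: complexI; rewrite -horner_trace_poly_real rmorph0 -rl.
    by congr (_.[_]); apply/eqP; rewrite eq_complex /= iml !eqxx.
  by rewrite normr0 ltNge ler0n.
have [w ew w1] := multiplier_exists (trace_poly V q).[E +i* y].
have wneq0 : w != 0.
  by apply/eqP => w0; move: w1; rewrite w0 sqnorm_real expr0n ler10.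
have hw : sqnorm w <= 2 * sqnorm (trace_poly V q).[E +i* y] + 2.
  have -> : w = (trace_poly V q).[E +i* y] - w^-1.
    apply: (mulfI wneq0); rewrite mulrBr divff// -expr2.
    by apply/eqP; rewrite -subr_eq0 -[X in _ == X]ew; apply/eqP; ring.
  apply: (le_trans (sqnormB _ _)); rewrite lerD2l ler_piMr//.
  have : sqnorm w * sqnorm w^-1 = 1.
    by rewrite -sqnormM divff// sqnorm_real expr1n.
  have := sqnorm_ge0 w^-1; move: (sqnorm w) w1 (sqnorm w^-1) => W W1 W'; nra.
rewrite horner_trace_poly in ew.
have := multiplier_growth q0 Vq ew y0 w1.
have -> : 1 + 2 * complex.Im (E +i* y) = 1 + eps ^+ 2 by rewrite /= /y; field.
move=> wq.
have b0 : 0 < 1 + eps ^+ 2 / 4 by rewrite ltr_wpDr// divr_ge0 ?sqr_ge0.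
rewrite expr_div_n ler_pdivrMr ?exprn_gt0// -exprM mulnC exprM.
move: ((1 + eps ^+ 2) ^+ q) ((1 + eps ^+ 2 / 4) ^+ q) big wq hT => A B A16 AW hT.
apply: (le_trans AW).
have T0 := sqnorm_ge0 (trace_poly V q).[E +i* y].
move: (sqnorm (trace_poly V q).[_]) T0 hT hw => T T0 hT.
move: (sqnorm w) w1 AW => W W1 AW hw.
(* From [16 <= A <= W^2]; it absorbs the constant in [W <= 2 T + 2]. *)
have W4 : 4 <= W by nra.
have WT : W <= 4 * T by lra.
have : (4 * T) ^+ 2 <= (4 * (D ^+ 2 * B)) ^+ 2.
  by rewrite ler_pXn2r ?nnegrE//; lra.
have : W ^+ 2 <= (4 * T) ^+ 2 by rewrite ler_pXn2r ?nnegrE//; lra.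
by move=> h1 h2; apply: (le_trans h1); apply: (le_trans h2); rewrite le_eqVlt; apply/orP; left; apply/eqP; ring.
Qed.

(** The discriminant is positive; the root whose square-root term has the sign of [D] is the larger
    one. *)
Lemma hyperbolic_multiplier (D : R) : 2 < `|D| ->
  exists2 w : R, w ^+ 2 - D * w + 1 = 0 & `|D| / 2 <= `|w|.
Proof.
move=> D2; have D4 : 4 < D ^+ 2.
  by rewrite -real_normK ?num_real//; move: (`|D|) D2 => d; nra.
set s := Num.sqrt (D ^+ 2 - 4); have s0 : 0 <= s by exact: sqrtr_ge0.
have s2 : s ^+ 2 = D ^+ 2 - 4 by rewrite sqr_sqrtr// subr_ge0 ltW.
have [D0|D0] := leP 0 D.
  exists ((D + s) / 2).
    have -> : ((D + s) / 2) ^+ 2 - D * ((D + s) / 2) + 1 = (s ^+ 2 - (D ^+ 2 - 4)) / 4 by field.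
    by rewrite s2 subrr mul0r.
  by rewrite !ger0_norm//; lra.
exists ((D - s) / 2).
  have -> : ((D - s) / 2) ^+ 2 - D * ((D - s) / 2) + 1 = (s ^+ 2 - (D ^+ 2 - 4)) / 4 by field.
  by rewrite s2 subrr mul0r.
by rewrite !ler0_norm//; lra.
Qed.

(** The rate [c] and the threshold [Q] precede [V], [q] and [E]: this uniformity allows the
    averaging length to be fixed before the rational approximant. *)
Lemma uniform_hyperbolicity (eps : R) : 0 < eps -> eps <= 1 ->
  exists2 c, 0 < c & exists Q, forall V q (E : R),
    (Q <= q)%N -> (0 < q)%N -> (forall n, V (n + q)%N = V n) ->
    (forall E', `|E' - E| < eps -> 2 < `|\tr (cocycle (fun n => E' - V n) q)|) ->
    exists w : R, [/\ w ^+ 2 - \tr (cocycle (fun n => E - V n) q) * w + 1 = 0,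
      w != 0 & c * q%:R <= ln `|w|].
Proof.
move=> e0 e1; set x := eps ^+ 2.
have x0 : 0 < x by rewrite exprn_gt0.
have x1 : x <= 1 by rewrite exprn_ile1// ltW.
set A := (1 + x) / (1 + x / 4) ^+ 2.
have A1 : 1 < A by rewrite /A ltr_pdivlMr ?exprn_gt0//; nra.
have lnA : 0 < ln A by rewrite ln_gt0.
have ln1x : 0 < ln (1 + x) by rewrite ln_gt0//; lra.
(* From [A^q <= 256 |w|^4]: half of [q * ln A] absorbs [ln 256], the other half is at most
   [4 * ln |w|]. The two thresholds give [16 <= (1 + x)^q] and this absorption. *)
exists (ln A / 8); first by rewrite divr_gt0.
exists (maxn (Num.truncn (ln 16 / ln (1 + x))).+1 (Num.truncn (2 * ln 256 / ln A)).+1).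
move=> V q E; rewrite geq_max => /andP[Q1 Q2] q0 Vq gap.
have q1 : ln 16 <= ln (1 + x) * q%:R.
  rewrite [leRHS]mulrC -ler_pdivrMr//; apply: ltW; apply: (lt_le_trans (truncnS_gt _)).
  by rewrite ler_nat.
have q2 : 2 * ln 256 <= ln A * q%:R.
  rewrite [leRHS]mulrC -ler_pdivrMr//; apply: ltW; apply: (lt_le_trans (truncnS_gt _)).
  by rewrite ler_nat.
have big : 16 <= (1 + eps ^+ 2) ^+ q.
  have p1 : 0 < 1 + x by lra.
  by rewrite -ler_ln ?posrE ?exprn_gt0// lnXn// -[leRHS]mulr_natr.
have := trace_growth q0 Vq e0 big gap; rewrite -/x -/A.
have D2 : 2 < `|\tr (cocycle (fun n => E - V n) q)| by apply: gap; rewrite subrr normr0.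
have [w ew Dw] := hyperbolic_multiplier D2.
move: (\tr _) ew D2 Dw => D ew D2 Dw h.
have w1 : 1 < `|w| by lra.
exists w; split=> //; first by rewrite -normr_gt0; lra.
have hw : A ^+ q <= 256 * `|w| ^+ 4.
  apply: (le_trans h); have : `|D| ^+ 4 <= (2 * `|w|) ^+ 4.
    by rewrite ler_pXn2r ?nnegrE//; lra.
  have -> : `|D| ^+ 4 = D ^+ 4 by rewrite -normrX ger0_norm// exprn_even_ge0.
  by rewrite exprMn; lra.
have : ln (A ^+ q) <= ln (256 * `|w| ^+ 4).
  by rewrite ler_ln ?posrE ?mulr_gt0 ?exprn_gt0//; lra.
clearbody A; have A0 : 0 < A by lra.
have w0 : 0 < `|w| by lra.
rewrite lnXn// lnM ?posrE ?exprn_gt0// lnXn// -[leLHS]mulr_natr -[X in _ + X]mulr_natr.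
by lra.
Qed.

End Floquet.

(** * Operator norms *)

Section OperatorNorm.
Variable R : realType.
Implicit Types (v w : 'cV[R]_2) (A : 'M[R]_2).

(** Identifies the plane with the complex numbers, so that the triangle inequality and homogeneity
    come from [normc]. *)
Lemma euclidean_normE v : euclidean_norm v = ComplexField.Normc.normc (v 0 0 +i* v 1 0).
Proof. by rewrite /euclidean_norm big_ord2. Qed.

Lemma euclidean_norm_ge0 v : 0 <= euclidean_norm v.
Proof. exact: sqrtr_ge0. Qed.

Lemma sqr_euclidean_norm v : euclidean_norm v ^+ 2 = v 0 0 ^+ 2 + v 1 0 ^+ 2.
Proof. by rewrite /euclidean_norm big_ord2 sqr_sqrtr// addr_ge0// sqr_ge0. Qed.

Lemma euclidean_normD v w : euclidean_norm (v + w) <= euclidean_norm v + euclidean_norm w.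
Proof.
rewrite !euclidean_normE !mxE.
exact: (le_normcD (v 0 0 +i* v 1 0) (w 0 0 +i* w 1 0)).
Qed.

Lemma euclidean_normZ (c : R) v : euclidean_norm (c *: v) = `|c| * euclidean_norm v.
Proof.
rewrite !euclidean_normE !mxE; have := ComplexField.Normc.normcM c%:C (v 0 0 +i* v 1 0).
rewrite /= !mul0r subr0 addr0 => ->.
by rewrite expr0n addr0 sqrtr_sqr.
Qed.

Lemma euclidean_norm_eq0 v : euclidean_norm v = 0 -> v = 0.
Proof.
move=> v0; have := sqr_euclidean_norm v; rewrite v0 expr0n => /esym/eqP.
rewrite paddr_eq0 ?sqr_ge0// !sqrf_eq0 => /andP[/eqP h0 /eqP h1].
by apply: cV2P; rewrite mxE.
Qed.

Lemma le_coord_euclidean_norm v i : `|v i 0| <= euclidean_norm v.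
Proof.
rewrite -(ler_pXn2r (n := 2)) ?nnegrE ?euclidean_norm_ge0// real_normK ?num_real//.
rewrite sqr_euclidean_norm; case: (ord2P i) => ->.
  by rewrite lerDl sqr_ge0.
by rewrite lerDr sqr_ge0.
Qed.

Lemma euclidean_norm_le v : euclidean_norm v <= `|v 0 0| + `|v 1 0|.
Proof.
rewrite -(ler_pXn2r (n := 2)) ?nnegrE ?euclidean_norm_ge0 ?addr_ge0//.
rewrite sqr_euclidean_norm sqrrD !real_normK ?num_real//.
by rewrite lerD2r lerDl mulrn_wge0// mulr_ge0.
Qed.

Lemma mul_euclidean_norm_le A v : euclidean_norm (A *m v) <=
  (`|A 0 0| + `|A 0 1| + (`|A 1 0| + `|A 1 1|)) * euclidean_norm v.
Proof.
apply: (le_trans (euclidean_norm_le _)); rewrite !mul2E mulrDl; apply: lerD;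
  apply: (le_trans (ler_normD _ _)); rewrite mulrDl !normrM;
  by apply: lerD; rewrite ler_wpM2l// le_coord_euclidean_norm.
Qed.

Let unit_image A :=
  [set euclidean_norm (A *m v) | v in [set v : 'cV[R]_2 | euclidean_norm v <= 1]].

Lemma euclidean_norm0 : euclidean_norm (0 : 'cV[R]_2) = 0.
Proof.
by have := euclidean_normZ 0 (0 : 'cV[R]_2); rewrite scaler0 normr0 mul0r.
Qed.

Lemma has_sup_unit_image A : has_sup (unit_image A).
Proof.
split.
  by exists (euclidean_norm (A *m 0)); exists 0 => //=; rewrite euclidean_norm0.
exists (`|A 0 0| + `|A 0 1| + (`|A 1 0| + `|A 1 1|)) => _ [v /= v1 <-].
apply: (le_trans (mul_euclidean_norm_le _ _)).
by rewrite ler_piMr// !addr_ge0.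
Qed.

Lemma operator_normP A v : euclidean_norm (A *m v) <= operator_norm A * euclidean_norm v.
Proof.
have [v0|v0] := eqVneq (euclidean_norm v) 0.
  by rewrite (euclidean_norm_eq0 v0) mulmx0 euclidean_norm0 mulr0.
have vp : 0 < euclidean_norm v by rewrite lt_neqAle eq_sym v0 euclidean_norm_ge0.
rewrite -ler_pdivrMr//.
have -> : euclidean_norm (A *m v) / euclidean_norm v =
    euclidean_norm (A *m ((euclidean_norm v)^-1 *: v)).
  by rewrite -scalemxAr euclidean_normZ ger0_norm ?invr_ge0 ?(ltW vp)// mulrC.
apply: sup_upper_bound; first exact: has_sup_unit_image.
exists ((euclidean_norm v)^-1 *: v) => //=.
by rewrite euclidean_normZ ger0_norm ?invr_ge0 ?(ltW vp)// mulVf.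
Qed.

Lemma operator_norm_le A (M : R) : 0 <= M ->
  (forall v, euclidean_norm (A *m v) <= M * euclidean_norm v) -> operator_norm A <= M.
Proof.
move=> M0 AM; apply: sup_le_ub; first by case: (has_sup_unit_image A).
move=> _ [v /= v1 <-]; apply: (le_trans (AM v)).
by rewrite ler_piMr.
Qed.

Lemma operator_norm_ge0 A : 0 <= operator_norm A.
Proof.
apply: sup_upper_bound; first exact: has_sup_unit_image.
exists 0; rewrite /= ?mulmx0 euclidean_norm0 ?ler01//.
Qed.

(** Twice the determinant is at most the sum of the squared entries, and each column, as the image
    of a unit vector, has norm at most that of [A]. *)
Lemma operator_norm_ge1 A : \det A = 1 -> 1 <= operator_norm A.
Proof.
move=> dA; have K0 := operator_norm_ge0 A.
have col (j : 'I_2) : A 0 j ^+ 2 + A 1 j ^+ 2 <= operator_norm A ^+ 2.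
  have := operator_normP A (delta_mx j 0 : 'cV[R]_2).
  have -> : euclidean_norm (delta_mx j 0 : 'cV[R]_2) = 1.
    rewrite /euclidean_norm (bigD1 j)//= big1 ?addr0; last first.
      by move=> i /negPf ij; rewrite mxE ij expr0n.
    by rewrite mxE !eqxx expr1n sqrtr1.
  rewrite mulr1 -(ler_pXn2r (n := 2)) ?nnegrE ?euclidean_norm_ge0//.
  by rewrite sqr_euclidean_norm -!colE !mxE.
have := col 0; have := col 1; move: dA; rewrite det2E.
move: (A 0 0) (A 0 1) (A 1 0) (A 1 1) => a b c d dA h1 h2.
rewrite -(ler_pXn2r (n := 2)) ?nnegrE// expr1n.
have := sqr_ge0 (a - d); have := sqr_ge0 (b + c); nra.
Qed.

(** Both norms are at least 1, where [ln] is 1-Lipschitz. *)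
Lemma ln_operator_norm_le A B (t : R) : \det A = 1 -> \det B = 1 -> 0 <= t ->
  (forall v, euclidean_norm (A *m v - B *m v) <= t * euclidean_norm v) ->
  ln (operator_norm A) <= ln (operator_norm B) + t.
Proof.
move=> dA dB t0 AB; have A1 := operator_norm_ge1 dA; have B1 := operator_norm_ge1 dB.
have AB' : operator_norm A <= operator_norm B + t.
  apply: operator_norm_le; first by rewrite addr_ge0// operator_norm_ge0.
  move=> v; rewrite -[A *m v](addrNK (B *m v)) mulrDl addrC.
  apply: (le_trans (euclidean_normD _ _)); exact: lerD (operator_normP _ _) (AB _).
move: (operator_norm A) (operator_norm B) A1 B1 AB' => x y x1 y1 xy.
have y0 : 0 < y by lra.
apply: (@le_trans _ _ (ln (y * (1 + t / y)))).
  rewrite ler_ln ?posrE; first by rewrite mulrDr mulr1 mulrCA divff ?gt_eqF// mulr1.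
    by lra.
  by rewrite mulr_gt0// ltr_wpDr// divr_ge0// ltW.
have ty : 0 <= t / y by rewrite divr_ge0// ltW.
rewrite lnM ?posrE//; last by rewrite ltr_wpDr.
rewrite lerD2l; apply: (@le_trans _ _ (t / y)).
  by apply: le_ln1Dx; lra.
by rewrite ler_pdivrMr// ler_peMr.
Qed.

(** The factors are replaced one at a time. A step has norm at most [K + 2], the bound on the sum of
    its absolute entries, and two steps differ only in the corner. *)
Lemma cocycle_perturbation (a b : nat -> R) (K d : R) n :
  0 <= K -> (forall k, `|a k| <= K) -> (forall k, `|b k| <= K) ->
  (forall k, (k <= n)%N -> `|a k - b k| <= d) ->
  forall v, euclidean_norm (cocycle a n *m v - cocycle b n *m v) <=
    n%:R * (K + 2) ^+ n * d * euclidean_norm v.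
Proof.
move=> K0 aK bK; set M := K + 2; have M1 : 1 <= M by rewrite /M; lra.
have M0 : 0 <= M by lra.
have stepM x v : `|x| <= K -> euclidean_norm (step x *m v) <= M * euclidean_norm v.
  move=> xK; apply: (le_trans (mul_euclidean_norm_le _ _)).
  rewrite ler_wpM2r ?euclidean_norm_ge0// !mxE /= normrN normr1 normr0 /M; lra.
have cocM m v : euclidean_norm (cocycle b m *m v) <= M ^+ m * euclidean_norm v.
  elim: m => [|m IHm] /=; first by rewrite mul1mx mul1r.
  rewrite -mulmxA exprS -mulrA; apply: (le_trans (stepM _ _ (bK _))).
  by rewrite ler_wpM2l.
elim: n => [|n IHn] abd v.
  by rewrite /= subrr euclidean_norm0 !mul0r.
rewrite /= -!mulmxA; set p := cocycle a n *m v; set r := cocycle b n *m v.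
have d0 : 0 <= d by apply: le_trans (abd 0%N _).
have -> : step (a n.+1) *m p - step (b n.+1) *m r =
    step (a n.+1) *m (p - r) + (step (a n.+1) - step (b n.+1)) *m r.
  by rewrite mulmxBr mulmxBl addrA subrK.
apply: (le_trans (euclidean_normD _ _)).
have h1 : euclidean_norm (step (a n.+1) *m (p - r)) <=
    n%:R * M ^+ n.+1 * d * euclidean_norm v.
  apply: (le_trans (stepM _ _ (aK _))).
  have := IHn (fun k kn => abd k (leqW kn)) v; rewrite -/p -/r => h.
  apply: (le_trans (ler_wpM2l M0 h)).
  by rewrite exprS le_eqVlt; apply/orP; left; apply/eqP; ring.
have h2 : euclidean_norm ((step (a n.+1) - step (b n.+1)) *m r) <=
    M ^+ n.+1 * d * euclidean_norm v.
  apply: (le_trans (mul_euclidean_norm_le _ _)).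
  rewrite !mxE /= !subrr !normr0 !addr0.
  apply: (@le_trans _ _ (d * (M ^+ n * euclidean_norm v))).
    apply: ler_pM; rewrite ?euclidean_norm_ge0 //; last exact: cocM.
    by have := abd n.+1 (leqnn _).
  rewrite mulrA [d * _]mulrC ler_wpM2r ?euclidean_norm_ge0// ler_wpM2r//.
  by rewrite ler_weXn2l.
apply: (le_trans (lerD h1 h2)).
by rewrite -natr1 le_eqVlt; apply/orP; left; apply/eqP; ring.
Qed.

Lemma sumrS_shift (g : nat -> R) q :
  \sum_(m < q) g m.+1 = \sum_(m < q) g m + g q - g 0%N.
Proof.
elim: q => [|q IHq]; first by rewrite !big_ord0 add0r subrr.
by rewrite !big_ord_recr /= IHq; ring.
Qed.

(* Summing [ln |u(m+n)| - ln |u m|] over one period telescopes, because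
   [ln |u|] increases by [ln |w|] per period. *)
Lemma multiplier_le_sum_ln (a : nat -> R) q n (w : R) :
  (forall k, a (k + q)%N = a k) ->
  w ^+ 2 - \tr (cocycle a q) * w + 1 = 0 -> w != 0 ->
  n%:R * ln `|w| <= \sum_(m < q) ln (operator_norm (cocycle (fun k => a (m + k)%N) n)).
Proof.
move=> aq ew w0.
have [|v v0 ev] := @eigenvector2 _ (cocycle a q) w; first by rewrite det_cocycle.
pose u := trajectory a v; pose N m := euclidean_norm (state u m).
have su : solution a u by exact: trajectory_solution.
have uq k : u (k + q)%N = w * u k by exact: bloch_trajectory.
(* The cocycle is invertible, so the state of an eigenvector never vanishes and its norm has a
   usable logarithm. *)
have N0 m : 0 < N m.
  rewrite lt_neqAle euclidean_norm_ge0 andbT eq_sym; apply/eqP => /euclidean_norm_eq0.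
  rewrite trajectoryE => h; move/eqP: v0; apply.
  have um : cocycle a m \in unitmx by rewrite unitmxE det_cocycle unitr1.
  by rewrite -[v](mulKmx um) h mulmx0.
have Nq m : ln (N (m + q)%N) = ln (N m) + ln `|w|.
  rewrite addrC -lnM ?posrE ?normr_gt0// -euclidean_normZ.
  by congr (ln (euclidean_norm _)); apply: cV2P; rewrite !mxE /= -?addSn uq.
have -> : n%:R * ln `|w| = \sum_(m < q) (ln (N (m + n)%N) - ln (N m)).
  elim: n => [|n IHn].
    by rewrite mul0r big1// => m _; rewrite addn0 subrr.
  rewrite -natr1 mulrDl mul1r IHn !sumrB.
  have -> : \sum_(m < q) ln (N (m + n.+1)%N) = \sum_(m < q) ln (N (m.+1 + n)%N).
    by apply: eq_bigr => m _; rewrite addSnnS.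
  by rewrite (sumrS_shift (fun m => ln (N (m + n)%N))) add0n addnC Nq; ring.
apply: ler_sum => m _; rewrite lerBlDr -lnM ?posrE//; last first.
  by apply: (lt_le_trans ltr01); apply: operator_norm_ge1; rewrite det_cocycle.
rewrite ler_ln ?posrE ?mulr_gt0//; last first.
  by apply: (lt_le_trans ltr01); apply: operator_norm_ge1; rewrite det_cocycle.
have sm : solution (fun k => a (m + k)%N) (fun k => u (m + k)%N).
  by move=> k; rewrite !addnS su.
have := operator_normP (cocycle (fun k => a (m + k)%N) n) (state (fun k => u (m + k)%N) 0).
rewrite -(state_cocycle n sm).
have sE k : state (fun k => u (m + k)%N) k = state u (m + k).
  by apply: cV2P; rewrite !mxE /= ?addnS.
by rewrite !sE addn0.
Qed.

End OperatorNorm.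

(** * Periodic functions and rational approximation *)

Section PeriodicContinuity.
Variables (R : realType) (h : R -> R).
Hypotheses (h_cont : continuous h) (h_periodic : forall x, h (x + 2 * pi) = h x).

Lemma periodic_int (m : int) x : h (x + 2 * pi * m%:~R) = h x.
Proof.
have hn (n : nat) y : h (y + 2 * pi * n%:R) = h y.
  elim: n => [|n IHn]; first by rewrite mulr0 addr0.
  by rewrite -[n.+1%:R]natr1 mulrDr mulr1 addrA h_periodic.
case: m => n; first exact: hn.
by rewrite NegzE mulrNz mulrN -(hn n.+1 (x - _)) subrK.
Qed.

Lemma reduce_period (x : R) : exists m : int, 0 <= x + 2 * pi * m%:~R <= 2 * pi.
Proof.
have p0 : 0 < 2 * pi :> R by rewrite mulr_gt0// pi_gt0.
exists (- Num.floor (x / (2 * pi))); have /andP[] := floor_itv (x / (2 * pi)).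
rewrite ler_pdivlMr// ltr_pdivrMr// intrD mulrNz => h1 h2.
by apply/andP; split; lra.
Qed.

(** Compactness of one period in near-covering form, the bound being the parameter tending to
    infinity. *)
Lemma periodic_bounded : exists2 K, 0 <= K & forall x, `|h x| <= K.
Proof.
have /compact_near_coveringP := @segment_compact R 0 (2 * pi).
move=> /(_ R (+oo)%R (fun M x => `|h x| <= M) _) H.
have /H[K [_ HK]] : forall x, `[0, 2 * pi]%classic x ->
    \forall x' \near x & i \near +oo, `|h x'| <= i.
  move=> x _; have /cvgrPdist_lt/(_ 1 ltr01) hx := @h_cont x.
  exists ([set y | `|h x - h y| < 1], [set M | `|h x| + 1 < M]).
    split=> //=; exists (`|h x| + 1); split=> //; exact: num_real.
  move=> [y M] /= [h1 h2]; apply: ltW; apply: le_lt_trans h2.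
  rewrite -[h y](subrK (h x)) addrC; apply: (le_trans (ler_normD _ _)).
  by rewrite lerD2l distrC ltW.
exists (`|K| + 1); first by rewrite addr_ge0.
move=> x; have [m xm] := reduce_period x; rewrite -(periodic_int m x).
apply: HK; last by rewrite /= in_itv.
by apply: (le_lt_trans (ler_norm _)); rewrite ltrDl.
Qed.

Lemma periodic_uniformly_continuous e : 0 < e ->
  exists2 d, 0 < d & forall x y, `|x - y| < d -> `|h x - h y| < e.
Proof.
move=> e0; have /compact_near_coveringP := @segment_compact R 0 (2 * pi).
move=> /(_ R (0^'+)%R (fun d x => forall y, `|x - y| < d -> `|h x - h y| < e) _) H.
have /H : forall x, `[0, 2 * pi]%classic x ->
    \forall x' \near x & d \near 0^'+, forall y, `|x' - y| < d -> `|h x' - h y| < e.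
  move=> x _; have e2 : 0 < e / 2 by rewrite divr_gt0.
  have /cvgrPdist_lt/(_ _ e2)/nbhs_ballP[d /= d0 hd] := @h_cont x.
  have d2 : 0 < d / 2 by rewrite divr_gt0.
  exists (ball x (d / 2), [set i | i < d / 2]).
    by split=> /=; [exact: nbhsx_ballx | exact: nbhs_right_lt].
  move=> [x' i] /=; rewrite /ball /= => -[xx' id] y yi.
  have b1 : `|h x - h x'| < e / 2 by apply: hd; rewrite /ball /=; lra.
  have b2 : `|h x - h y| < e / 2.
    apply: hd; rewrite /ball /= -(subrKA x'); apply: (le_lt_trans (ler_normD _ _)); lra.
  rewrite -(subrKA (h x)); apply: (le_lt_trans (ler_normD _ _)).
  by rewrite distrC; lra.
case=> d /= d0 hd; exists (d / 2); first by rewrite divr_gt0.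
(* Both points move by the same multiple of the period, keeping their distance; only [x] has to land
   in the compact interval. *)
move=> x y xy; have [m xm] := reduce_period x.
rewrite -(periodic_int m x) -(periodic_int m y).
apply: (hd (d / 2)) => //.
- by rewrite /= sub0r normrN ger0_norm; lra.
- by rewrite /= divr_gt0.
- by rewrite opprD addrACA subrr addr0.
Qed.

End PeriodicContinuity.

(** A lower Riemann sum on cells of width [s]; the induction splits off the last cell. *)
Lemma Rintegral_ge_step (R : realType) (g : R -> R) (s : R) (y : nat -> R) q :
  continuous g -> 0 <= s ->
  (forall k t, (k < q)%N -> s * k%:R <= t <= s * k.+1%:R -> y k <= g t) ->
  s * \sum_(k < q) y k <= \int[lebesgue_measure]_(t in `[0, s * q%:R]) g t.
Proof.
move=> cg s0; elim: q => [|q IHq] yg.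
  rewrite big_ord0 !mulr0 set_itv1; by rewrite Rintegral_set1.
rewrite big_ord_recr /= mulrDr.
have cgc a b : lebesgue_measure.-integrable `[a, b] (EFin \o g).
  apply: continuous_compact_integrable; first exact: segment_compact.
  exact: continuous_subspaceT.
have sq : s * q%:R <= s * q.+1%:R by rewrite ler_wpM2l// ler_nat.
have sq0 : 0 <= s * q%:R by rewrite mulr_ge0.
have cst a b : lebesgue_measure.-integrable `[a, b] (EFin \o (fun=> y q)).
  apply: continuous_compact_integrable; first exact: segment_compact.
  apply: continuous_subspaceT => x; exact: cvg_cst.
have sub : `]s * q%:R, s * q.+1%:R]%classic `<=` `[s * q%:R, s * q.+1%:R]%classic.
  by move=> t /=; rewrite !in_itv /= => /andP[/ltW-> ->].
have := @Rintegral_itvB R g (BLeft 0) (BRight (s * q.+1%:R)) (s * q%:R) (cgc _ _).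
rewrite !bnd_simp => /(_ sq0 sq) /eqP; rewrite subr_eq => /eqP ->.
rewrite addrC lerD//; last by apply: IHq => k t kq; apply: yg; exact: leqW.
apply: (@le_trans _ _ (\int[lebesgue_measure]_(t in `]s * q%:R, s * q.+1%:R]) y q)).
  have bE : s * q.+1%:R = s * q%:R + s by rewrite -[q.+1%:R]natr1 mulrDr mulr1.
  rewrite Rintegral_cst//= lebesgue_measure_itv/= lte_fin bE.
  rewrite ltrDl; case: ltP => [s1|s1]; last first.
    by rewrite (le_anti (introT andP (conj s1 s0))) mulr0 mul0r.
  by rewrite -EFinB /= addrAC subrr add0r mulrC.
apply: le_Rintegral => //.
- by eapply integrableS; [| |exact: sub|exact: cst]; exact: measurable_itv.
- by eapply integrableS; [| |exact: sub|exact: cgc]; exact: measurable_itv.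
- by move=> t /=; rewrite in_itv /= => /andP[/ltW t1 t2]; apply: yg; rewrite ?t1.
Qed.

(** Denominators are excluded one at a time: for [q = Q + 1], [q * alpha] lies strictly between two
    consecutive integers, so fractions over [q] stay away from [alpha]. *)
Lemma irrational_denq_large (R : realType) (alpha : R) (Q : nat) : irrational alpha ->
  exists2 delta, 0 < delta &
    forall r : rat, `|ratr r - alpha| < delta -> (Q < `|denq r|)%N.
Proof.
move=> /[dup] ia; rewrite /irrational /= => na.
elim: Q => [|Q [d d0 Hd]].
  by exists 1 => // r _; rewrite absz_gt0 denq_neq0.
pose q : R := Q.+1%:R; have q0 : 0 < q by rewrite ltr0n.
have /andP[f1 f2] := floor_itv (q * alpha); set m := Num.floor _ in f1 f2.
have f1' : m%:~R < q * alpha.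
  rewrite lt_neqAle f1 andbT; apply/eqP => e; apply: na; exists (m%:~R / Q.+1%:R) => //.
  rewrite fmorph_div /= rmorph_int ratr_nat e -/q mulrAC divff ?mul1r// gt_eqF//.
pose e := Num.min (q * alpha - m%:~R) ((m + 1)%:~R - q * alpha) / q.
have e0 : 0 < e by rewrite divr_gt0// lt_min !subr_gt0 f1' f2.
exists (Num.min d e); first by rewrite lt_min d0.
move=> r; rewrite lt_min => /andP[/Hd rd re]; rewrite ltn_neqAle rd andbT.
apply/eqP => rQ.
have rE : q * ratr r = (numq r)%:~R :> R.
  have dq : (denq r)%:~R = q :> R by rewrite /q rQ natr_absz gtr0_norm// denq_gt0.
  by rewrite /ratr dq mulrC divfK// gt_eqF.
move: re; rewrite /e ltr_pdivlMr// -[X in _ * X]gtr0_norm// -normrM mulrBl.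
rewrite [ratr r * _]mulrC rE [alpha * _]mulrC lt_min => /andP[n1 n2].
have [le|lt] := leP (numq r) m.
  have : (numq r)%:~R <= m%:~R :> R by rewrite ler_int.
  by move=> h; move: n1; rewrite ler0_norm; lra.
have : (m + 1)%:~R <= (numq r)%:~R :> R by rewrite ler_int lezD1.
by move=> h; move: n2; rewrite ger0_norm; lra.
Qed.

(** * Averaging over the phase *)

Section Phase.
Variables (R : realType) (f : R[i] -> R[i]).
Let h (x : R) : R := complex.Re (f x%:C).
Hypotheses (h_cont : continuous h) (h_periodic : forall x, h (x + 2 * pi) = h x).

Let growth E n alpha theta := ln (operator_norm (Phi f E alpha theta n)).

Lemma det_Phi E alpha theta n : \det (Phi f E alpha theta n) = 1.
Proof. by rewrite Phi_cocycle det_cocycle. Qed.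

Lemma growth_period (m : int) E n alpha theta :
  growth E n alpha (theta + 2 * pi * m%:~R) = growth E n alpha theta.
Proof.
rewrite /growth !Phi_cocycle; congr (ln (operator_norm (cocycle _ n))).
apply/funext => k; congr (E - _).
by rewrite /potential addrA -/(h _) -/(h _) (periodic_int h_periodic).
Qed.

(** For fixed [n] the arguments of the potential up to site [n] move by at most [2 pi n |alpha' -
    alpha| + |theta - theta'|], and [h] is bounded and uniformly continuous. *)
Lemma growth_uniformly_continuous E n alpha kappa : 0 < kappa ->
  exists2 d, 0 < d & forall alpha' theta theta',
    `|alpha' - alpha| < d -> `|theta - theta'| < d ->
    growth E n alpha' theta <= growth E n alpha theta' + kappa.
Proof.
move=> k0; have [K K0 hK] := periodic_bounded h_cont h_periodic.
pose C := n%:R * (`|E| + K + 2) ^+ n.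
have M0 : 0 <= `|E| + K + 2 by rewrite !addr_ge0.
have C0 : 0 <= C by rewrite mulr_ge0// exprn_ge0.
(* [C] vanishes for [n = 0], hence the denominator [C + 1]. *)
have e0 : 0 < kappa / (C + 1) by rewrite divr_gt0//; lra.
have [d d0 hd] := periodic_uniformly_continuous h_cont h_periodic e0.
have N0 : 0 < 2 * pi * n%:R + 1 :> R by rewrite ltr_wpDl// !mulr_ge0// pi_ge0.
pose d' := d / (2 * pi * n%:R + 1); exists d'; first by rewrite divr_gt0.
have dE : 2 * pi * n%:R * d' + d' = d by rewrite -[X in _ + X]mul1r -mulrDl mulrC divfK// gt_eqF.
move=> alpha' theta theta' da dt.
rewrite /growth; apply: (@le_trans _ _ (ln (operator_norm (Phi f E alpha theta' n))
    + C * (kappa / (C + 1)))); last first.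
  rewrite lerD2l mulrCA ler_piMr ?(ltW k0)// ler_pdivrMr; lra.
apply: ln_operator_norm_le; rewrite ?det_Phi//; first by rewrite mulr_ge0// ltW.
rewrite !Phi_cocycle; apply: cocycle_perturbation.
- by rewrite addr_ge0.
- move=> k; apply: (le_trans (ler_normB _ _)); rewrite lerD2l; exact: hK.
- move=> k; apply: (le_trans (ler_normB _ _)); rewrite lerD2l; exact: hK.
move=> k kn; have xyE (x y : R) : E - x - (E - y) = - (x - y) by ring.
rewrite xyE normrN; apply: ltW; apply: hd.
have -> : 2 * pi * alpha' * k%:R + theta - (2 * pi * alpha * k%:R + theta') =
   2 * pi * k%:R * (alpha' - alpha) + (theta - theta') by ring.
apply: (le_lt_trans (ler_normD _ _)); rewrite normrM ger0_norm ?mulr_ge0 ?pi_ge0// -dE.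
apply: ler_ltD => //; apply: ler_pM => //; rewrite ?mulr_ge0 ?pi_ge0//; last exact: ltW.
by rewrite ler_wpM2l ?mulr_ge0 ?pi_ge0// ler_nat.
Qed.

Lemma continuous_growth E n alpha : continuous (growth E n alpha).
Proof.
move=> theta; apply/cvgrPdist_lt => e e0.
have e2 : 0 < e / 2 by rewrite divr_gt0.
have [d d0 hd] := growth_uniformly_continuous E n alpha e2.
apply/nbhs_ballP; exists d => //= t; rewrite /ball /= => td.
have aa : `|alpha - alpha| < d by rewrite subrr normr0.
have h1 := hd alpha theta t aa td; rewrite distrC in td; have h2 := hd alpha t theta aa td.
by rewrite ltr_norml; apply/andP; split; lra.
Qed.

(** Modulo [2 pi] the orbit of a rotation by [p/q] is an equally spaced grid of mesh [2 pi / q]; [t]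
    is the remainder of [theta] modulo the mesh. *)
Lemma rational_rotation_sum (r : rat) (theta : R) (g : R -> R) :
  (forall (m : int) x, g (x + 2 * pi * m%:~R) = g x) ->
  exists2 t, 0 <= t <= 2 * pi / `|denq r|%:R &
    \sum_(m < `|denq r|) g (theta + 2 * pi * ratr r * m%:R) =
    \sum_(k < `|denq r|) g (t + 2 * pi / `|denq r|%:R * k%:R).
Proof.
move=> gper; set q := `|denq r|%N; pose s : R := 2 * pi / q%:R.
have q0 : (0 < q)%N by rewrite absz_gt0 denq_neq0.
have qR : 0 < q%:R :> R by rewrite ltr0n.
have qZ : (q%:Z : int) = denq r by rewrite /q gtz0_abs// denq_gt0.
have s0 : 0 < s by rewrite divr_gt0// mulr_gt0// pi_gt0.
have sq : s * q%:R = 2 * pi by rewrite /s divfK// gt_eqF.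
pose a := Num.floor (theta / s); pose t := theta - s * a%:~R.
have st m : 2 * pi * ratr r * m%:R = s * (numq r * m%:Z)%:~R.
  have -> : ratr r = (numq r)%:~R / q%:R :> R by rewrite /ratr -qZ.
  by rewrite intrM /s; field; rewrite gt_eqF.
exists t.
  have /andP[] := floor_itv (theta / s); rewrite -/a ler_pdivlMr// ltr_pdivrMr// intrD mulr1z.
  by rewrite -/s /t => h1 h2; apply/andP; split; lra.
have qz0 : 0 < q%:Z by rewrite ltz_nat.
have mod_lt (x : int) : (`|(x %% q)%Z| < q)%N.
  by rewrite -ltz_nat gez0_abs ?modz_ge0 ?gt_eqF// ltz_pmod.
(* The [m]-th orbit point is [t + s * (p * m + a)]; coprimality of [p] and [q] makes the residue map
   a permutation. *)
pose sg (m : 'I_q) : 'I_q := Ordinal (mod_lt (numq r * m%:Z + a)).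
have sg_inj : injective sg.
  move=> m m' /(congr1 val) /= /(congr1 Posz).
  rewrite !gez0_abs ?modz_ge0 ?gt_eqF// => /eqP; rewrite eqz_mod_dvd.
  rewrite opprD addrACA subrr addr0 -mulrBr Gauss_dvdzr; last first.
    by rewrite coprimezE coprime_sym coprime_num_den.
  rewrite -eqz_mod_dvd -qZ !modz_small ?le0z_nat ?ltz_nat ?ltn_ord//.
  by move=> /eqP[] /val_inj.
rewrite [RHS](reindex_inj sg_inj) /=; apply: eq_bigr => m _.
set x := numq r * m%:Z + a.
have eR : (numq r * m%:Z)%:~R = (x %/ q)%Z%:~R * q%:R + (x %% q)%Z%:~R - a%:~R :> R.
  by rewrite pmulrn -intrM -intrD -divz_eq -intrB addrK.
rewrite -[LHS](gper (- (x %/ q)%Z)) st eR; congr g.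
rewrite (natr_absz _ (x %% q)%Z) ger0_norm ?modz_ge0 ?gt_eqF// -/s mulrNz -sq /t; ring.
Qed.

Lemma potential_periodic (r : rat) theta n :
  potential f (ratr r) theta (n + `|denq r|) = potential f (ratr r) theta n.
Proof.
have qR : `|denq r|%:R != 0 :> R by rewrite pnatr_eq0 absz_eq0 denq_neq0.
rewrite /potential -/(h _) -/(h _) -[RHS](periodic_int h_periodic (numq r)); congr h.
have -> : ratr r = (numq r)%:~R / `|denq r|%:R :> R.
  by rewrite /ratr natr_absz gtr0_norm ?denq_gt0.
by rewrite natrD; field.
Qed.

(* Upper semicontinuity of the Lyapunov exponent along the rationals, uniformly
   in the phase. *)
Lemma rational_growth_le E n alpha kappa : 0 < kappa -> irrational alpha ->
  forall Q, exists2 d, 0 < d & forall (r : rat) theta,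
    `|ratr r - alpha| < d -> (Q < `|denq r|)%N /\
    \sum_(m < `|denq r|) growth E n (ratr r) (theta + 2 * pi * ratr r * m%:R) <=
    `|denq r|%:R * ((2 * pi)^-1 *
      \int[lebesgue_measure]_(t in `[0, 2 * pi]) growth E n alpha t + kappa).
Proof.
move=> k0 ia Q; have [d d0 hd] := growth_uniformly_continuous E n alpha k0.
have p0 : 0 < 2 * pi :> R by rewrite mulr_gt0// pi_gt0.
(* A denominator above [2 pi / d] brings the mesh below [d], so each grid value less [kappa] bounds
   the growth at [alpha] from below on its cell. *)
have [d' d'0 hd'] := irrational_denq_large (maxn Q (Num.truncn (2 * pi / d)).+1) ia.
exists (Num.min d d'); first by rewrite lt_min d0.
move=> r theta; rewrite lt_min => /andP[rd /hd']; rewrite gtn_max => /andP[Qq dq].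
split=> //; set q := `|denq r|%N in dq *.
have q0 : 0 < q%:R :> R by rewrite ltr0n; apply: leq_ltn_trans Qq.
pose s : R := 2 * pi / q%:R; have s0 : 0 < s by rewrite divr_gt0.
have sq : s * q%:R = 2 * pi by rewrite /s divfK// gt_eqF.
have sd : s < d.
  rewrite /s ltr_pdivrMr// [ltRHS]mulrC -ltr_pdivrMr//; apply: (lt_trans (truncnS_gt _)).
  by rewrite ltr_nat.
have [t /andP[t0 ts] ->] := @rational_rotation_sum r theta (growth E n (ratr r))
  (fun m x => growth_period m E n (ratr r) x).
rewrite -/q -/s in ts *.
have := @Rintegral_ge_step R (growth E n alpha) s
  (fun k => growth E n (ratr r) (t + s * k%:R) - kappa) q (@continuous_growth E n alpha) (ltW s0).
rewrite sq => H.
have {H} : s * \sum_(k < q) (growth E n (ratr r) (t + s * k%:R) - kappa) <=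
    \int[lebesgue_measure]_(t in `[0, 2 * pi]) growth E n alpha t.
  apply: H => k x _; rewrite -[k.+1%:R]natr1 mulrDr mulr1 => /andP[x1 x2].
  rewrite lerBlDr; apply: hd => //; rewrite ltr_norml; apply/andP; split; lra.
rewrite sumrB sumr_const card_ord -[kappa *+ _]mulr_natr.
set S := \sum_(_ < _) _; set I := Rintegral _ _ _ => h1.
rewrite -(ler_pM2l s0) (le_trans _ (_ : I + s * q%:R * kappa <= _))//.
  lra.
by rewrite mulrA sq [leRHS]mulrDr mulVKf ?gt_eqF.
Qed.

Lemma zero_lyapunov_near_sigma E alpha eps : irrational alpha -> 0 < eps ->
  zero_lyapunov_set f alpha E -> exists2 d, 0 < d &
    forall (r : rat) theta, `|ratr r - alpha| < d ->
      exists2 E', `|E' - E| < eps & sigma f r theta E'.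
Proof.
(* [uniform_hyperbolicity] requires a radius at most 1. *)
move=> ia eps0 zE; pose e := Num.min eps 1.
have e0 : 0 < e by rewrite lt_min eps0 ltr01.
have e1 : e <= 1 by rewrite ge_min lexx orbT.
have [c c0 [Q HQ]] := uniform_hyperbolicity e0 e1.
(* The phase average and the error [kappa] each cost less than or equal to [n * c / 4] per orbit
   point, together below the [n * c] forced by hyperbolicity. The length is [N.+1] so that division
   by it is meaningful. *)
have c4 : 0 < c / 4 by rewrite divr_gt0.
move: zE => /cvgrPdist_lt/(_ _ c4)[N _ /(_ N.+1 (leqnSn N))].
set n := N.+1; rewrite sub0r normrN => /(le_lt_trans (ler_norm _)).
have n0 : 0 < n%:R :> R by rewrite ltr0n.
set I := (2 * pi)^-1 * _ => In.
have nk : 0 < n%:R * (c / 4) by rewrite mulr_gt0.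
have [d d0 hd] := @rational_growth_le E n alpha _ nk ia Q.
exists d => // r theta /(hd r theta)[]; rewrite -/I; set q := `|denq r|%N => Qq sum_le.
apply: contrapT => nE.
have gap E' : `|E' - E| < e ->
    2 < `|\tr (cocycle (fun k => E' - potential f (ratr r) theta k) q)|.
  move=> E'E; rewrite ltNge; apply/negP => tr2; apply: nE; exists E'.
    by apply: lt_le_trans E'E _; rewrite ge_min lexx.
  apply: (@essential_spectrum_trace _ _ _ _ _ q).
  - by apply: leq_ltn_trans Qq.
  - exact: potential_periodic.
  - by rewrite Phi_cocycle.
have q0 : (0 < q)%N by apply: leq_ltn_trans Qq.
have per : forall k, potential f (ratr r) theta (k + q) = potential f (ratr r) theta k.
  by move=> k; exact: potential_periodic.
have [w [ew w0 cw]] := HQ _ q E (ltnW Qq) q0 per gap.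
have ap k : E - potential f (ratr r) theta (k + q) = E - potential f (ratr r) theta k.
  by rewrite per.
have := multiplier_le_sum_ln n ap ew w0.
(* Moving the sites by [m] amounts to advancing the phase by [2 pi r m]. *)
have -> : \sum_(m < q) ln (operator_norm
      (cocycle (fun k => E - potential f (ratr r) theta (m + k)) n)) =
    \sum_(m < q) growth E n (ratr r) (theta + 2 * pi * ratr r * m%:R).
  apply: eq_bigr => m _; rewrite /growth Phi_cocycle.
  congr (ln (operator_norm (cocycle _ n))); apply/funext => k; congr (E - _).
  by rewrite /potential natrD; congr (complex.Re (f _%:C)); ring.
move=> h1; have h2 := le_trans h1 sum_le.
have In' : I < c / 4 * n%:R by rewrite mulrC in In; rewrite -ltr_pdivrMr.
have qR : 0 < q%:R :> R by rewrite ltr0n.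
have h3 : n%:R * (c * q%:R) <= n%:R * ln `|w| by rewrite ler_wpM2l// ltW.
have h4 : q%:R * (I + n%:R * (c / 4)) < q%:R * (c / 4 * n%:R + n%:R * (c / 4)).
  by rewrite ltr_pM2l// ltrD2r.
have := mulr_gt0 (mulr_gt0 n0 c0) qR; lra.
Qed.

End Phase.

(** * From analyticity on the strip to the inclusion *)

Lemma analytic_real_continuous (R : realType) (eta : R) (f : R[i] -> R[i]) : 0 <= eta ->
  analytic_on f (strip eta) -> continuous (fun x : R => complex.Re (f x%:C)).
Proof.
move=> eta0 fa x; have sx : strip eta x%:C by rewrite /strip /= normr0.
have /nbhs_singleton/derivable1_diffP/differentiable_continuous fc := fa x%:C sx.
apply/cvgrPdist_lt => e e0.
have e0' : 0 < e%:C by rewrite ltcR.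
move/cvgrPdist_lt : fc => /(_ _ e0')/nbhs_ballP[d /= d0 hd].
(* Radii of balls here are elements of [R[i]], and positivity there includes being real. *)
have [d1 d2] : complex.Im d = 0 /\ 0 < complex.Re d.
  by move: d0; rewrite ltcE /= => /andP[/eqP -> ->].
apply/nbhs_ballP; exists (complex.Re d) => //= y; rewrite /ball /= => xy.
have /hd : ball (x%:C : R[i]^o) d y%:C.
  rewrite /ball /= -rmorphB normc_def /= expr0n addr0 sqrtr_sqr ltcE /= d1 eqxx /=.
  exact: xy.
rewrite /= -ltcR; apply: le_lt_trans.
apply: le_trans (normc_ge_Re _).
by case: (f _) (f _) => [? ?] [? ?] /=.
Qed.

Theorem theorem1p2 (R : realType) (eta : R) (f : R[i] -> R[i])
    (eta_gt0 : 0 < eta)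
    (f_analytic : analytic_on f (strip eta))
    (f_periodic : forall z, strip eta z -> f (z + (2 * pi)%:C) = f z)
    (f_real : forall x : R, complex.Im (f x%:C) = 0)
    (alpha : R) (alpha_irrational : irrational alpha) :
  zero_lyapunov_set f alpha `<=`
    \bigcap_(eps in [set e : R | 0 < e]) liminf_S_minus f alpha eps.
Proof.
move=> E zE eps /= eps0.
have h_cont := analytic_real_continuous (ltW eta_gt0) f_analytic.
have h_periodic (x : R) : complex.Re (f (x + 2 * pi)%:C) = complex.Re (f x%:C).
  by rewrite rmorphD /= f_periodic// /strip /= normr0 ltW.
have [d d0 hd] := zero_lyapunov_near_sigma h_cont h_periodic alpha_irrational eps0 zE.
(* [d] is independent of the phase, as the intersection over [theta] demands. *)
exists d => //= r rd theta _ /=.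
have [E' E'E sE'] := hd r theta rd.
apply: (@le_lt_trans _ _ (`|E - E'|)%:E); last by rewrite lte_fin distrC.
by apply: ereal_inf_lbound; exists E'.
Qed.
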